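(* If a rectifiable space $G$ is Fréchet-Urysohn, then it is strongly Fréchet-Urysohn.
   Context: All spaces are assumed to be $T_1$ and regular. A topological space $G$ is a rectifiable space if there are a surjective homeomorphism $\varphi: G\times G\to G\times G$ and an element $e\in G$ such that $\pi_1\circ\varphi=\pi_1$ and $\varphi(x,x)=(x,e)$ for every $x\in G$, where $\pi_1:G\times G\to G$ is the projection to the first coordinate. A space $X$ is Fréchet-Urysohn if for every $A\subset X$ and every $x\in\overline{A}$ there is a sequence of points of $A$ converging to $x$. A space $X$ is strongly Fréchet-Urysohn if for every $x\in X$ and each sequence $\{A_n:n\in\mathbb{N}\}$ of subsets of $X$ with $x\in\bigcap_{n\in\mathbb{N}}\overline{A_n}$, there is a sequence $\{a_n:n\in\mathbb{N}\}$ in $X$ converging to $x$ and intersecting infinitely many members of the sequence $\{A_n\}$ (that is, meeting $A_n$ for infinitely many $n$). *)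

(* Defs.v *)
From HB Require Import structures.
From mathcomp Require Import all_boot all_order.
From mathcomp Require Import boolp classical_sets functions cardinality filter.
From mathcomp Require Import topology.

Set Implicit Arguments.
Unset Strict Implicit.
Unset Printing Implicit Defensive.

Local Open Scope classical_set_scope.

(* Surjectivity of [f] is part of the existence of a two-sided inverse. *)
Definition homeomorphism (X Y : topologicalType) (f : X -> Y) : Prop :=
  continuous f /\
  exists g : Y -> X, [/\ cancel f g, cancel g f & continuous g].

Definition rectifiable (G : topologicalType) : Prop :=
  exists (phi : G * G -> G * G) (e : G),
    [/\ homeomorphism phi,
        forall p : G * G, (phi p).1 = p.1 &
        forall x : G, phi (x, x) = (x, e)].

Definition frechet_urysohn (X : topologicalType) : Prop :=
  forall (A : set X) (x : X), closure A x ->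
    exists a : nat -> X, (forall n, A (a n)) /\ a @ \oo --> x.

(* The sets [A n] need not be decreasing, and the term of [a] that witnesses
   [range a `&` A n !=set0] need not be [a n]. *)
Definition strongly_frechet_urysohn (X : topologicalType) : Prop :=
  forall (x : X) (A : nat -> set X), (\bigcap_n closure (A n)) x ->
    exists a : nat -> X,
      a @ \oo --> x /\ infinite_set [set n | range a `&` A n !=set0].

(* Main.v *)
Require Import Defs.
From mathcomp Require Import all_boot all_order.
From mathcomp Require Import boolp classical_sets functions cardinality filter.
From mathcomp Require Import topology.

Set Implicit Arguments.
Unset Strict Implicit.
Unset Printing Implicit Defensive.

Local Open Scope classical_set_scope.

(** A rectification provides continuous translations [m b x] of [G] that carry
    [x] to [b], depend continuously on [b] and [x], and satisfy
    [m x b \o m b x = id] ([rectifiable_translation]); in a topological group,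
    [m b x y = b * x^-1 * y].

    Let [x] be in the closure of every [A n].  If [x] is isolated, it belongs to
    every [A n] and a constant sequence will do.  Otherwise the
    Frechet-Urysohn property gives points [b n <> x] converging to [x].  The
    translate of [A n] by [m (b n) x] accumulates at [b n]; keep only the part
    of it lying outside some neighborhood of [x], which still accumulates at
    [b n] when that neighborhood is small.  The union [B] over [n] of
    these truncated translates accumulates at every [b n], hence at [x], so
    some sequence [y k] in [B] converges to [x].  Since the [n]-th translate
    avoids a neighborhood of [x], the index [i k] of the translate that
    contains [y k] tends to infinity.  Translating back,
    [m x (b (i k)) (y k)] is a point of [A (i k)], and it converges to
    [m x x x = x] by joint continuity. *)

(** With [phi^-1 (x, y) = (x, p x y)] and [phi (x, y) = (x, q x y)], the map is
    [m b x y = p b (q x y)].  The maps [p x] and [q x] are mutually inverse,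
    whence the cancellation law; [q x] sends [x] to the base point [e], and
    [p b] sends [e] to [b]. *)
Lemma rectifiable_translation (G : topologicalType) : rectifiable G ->
  exists m : G * G * G -> G,
    [/\ continuous m, forall b x, m (b, x, x) = b &
        forall b x y, m (x, b, m (b, x, y)) = y].
Proof.
move=> [phi [e [[phi_cont [psi [phiK psiK psi_cont]]] phi1 phi_diag]]].
have psi1 u : (psi u).1 = u.1 by rewrite -phi1 psiK.
exists (fun t => (psi (t.1.1, (phi (t.1.2, t.2)).2)).2); split.
- have fst_cont (X Y : topologicalType) : continuous (@fst X Y).
    by move=> u; exact: cvg_fst.
  have snd_cont (X Y : topologicalType) : continuous (@snd X Y).
    by move=> u; exact: cvg_snd.
  have comp_cont (X Y Z : topologicalType) (f : X -> Y) (g : Y -> Z) :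
      continuous f -> continuous g -> continuous (fun x => g (f x)).
    by move=> f_cont g_cont x; exact: continuous_comp (f_cont x) (g_cont _).
  have pair_cont (X Y Z : topologicalType) (f : X -> Y) (g : X -> Z) :
      continuous f -> continuous g -> continuous (fun x => (f x, g x)).
    by move=> f_cont g_cont x; exact: cvg_pair (f_cont x) (g_cont x).
  have phi_part : continuous (fun t : G * G * G => phi (t.1.2, t.2)).
    apply: (comp_cont _ _ _ (fun t => (t.1.2, t.2)) phi) => //.
    apply: pair_cont; last exact: snd_cont.
    exact: (comp_cont _ _ _ fst snd (fst_cont _ _) (snd_cont _ _)).
  have psi_part : continuous (fun t => psi (t.1.1, (phi (t.1.2, t.2)).2)).
    apply: (comp_cont _ _ _ (fun t => (t.1.1, (phi (t.1.2, t.2)).2)) psi) => //.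
    apply: pair_cont.
      exact: (comp_cont _ _ _ fst fst (fst_cont _ _) (fst_cont _ _)).
    exact: (comp_cont _ _ _ _ snd phi_part (snd_cont _ _)).
  exact: (comp_cont _ _ _ _ snd psi_part (snd_cont _ _)).
- by move=> b x /=; rewrite phi_diag -(phi_diag b) phiK.
- move=> b x y /=; set z := (phi (x, y)).2.
  have -> : (b, (psi (b, z)).2) = psi (b, z).
    by rewrite [RHS]surjective_pairing psi1.
  rewrite psiK /=; have <- : phi (x, y) = (x, z).
    by rewrite [LHS]surjective_pairing phi1.
  by rewrite phiK.
Qed.

Lemma accessible_regular_separated (T : topologicalType) (x b : T) :
  accessible_space T -> regular_space T -> b <> x ->
  exists U, nbhs b U /\ nbhs x (~` U).
Proof.
move=> T1 reg bx.
have /reg [V Vx Vb] : nbhs x (~` [set b]).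
  apply: open_nbhs_nbhs; split; last by move=> /esym.
  by apply: closed_openC; exact: accessible_closed_set1.
exists (~` closure V); split.
  apply: open_nbhs_nbhs; split; first exact/closed_openC/closed_closure.
  by move=> /Vb; apply.
by rewrite setCK; apply: filterS Vx; exact: subset_closure.
Qed.

Lemma closure_setC1 (T : topologicalType) (x : T) :
  ~ nbhs x [set x] -> closure (~` [set x]) x.
Proof.
move=> nx N Nx; apply: contrapT => /set0P/negP/negPn/eqP N0; apply: nx.
apply: filterS Nx => y Ny /=; apply: contrapT => yx.
by have : (~` [set x] `&` N) y by []; rewrite N0.
Qed.

(** Each of the finitely many values below [M] is eventually avoided, so
    eventually all of them are. *)
Lemma cvg_indices (i : nat -> nat) :
  (forall n, \forall k \near \oo, i k <> n) -> i @ \oo --> \oo.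
Proof.
move=> i_ne P [M _ MP].
suff i_ge : \forall k \near \oo, M <= i k by apply: filterS i_ge => k; exact: MP.
elim: {P MP} M => [|M IH]; first by apply: filterE.
apply: filterS2 IH (i_ne M) => k Mk /eqP iM.
by rewrite ltn_neqAle eq_sym iM Mk.
Qed.

Theorem theorem3p8 (G : topologicalType)
    (G_T1 : accessible_space G) (G_regular : regular_space G)
    (G_rectifiable : rectifiable G) (G_FU : frechet_urysohn G) :
  strongly_frechet_urysohn G.
Proof.
move=> x A clA.
have [x_isolated|/closure_setC1/G_FU[b [b_ne b_cvg]]] := pselect (nbhs x [set x]).
  exists (fun=> x); split; first exact: cvg_cst.
  apply: sub_infinite_set infinite_nat => n _.
  have [y [Ay yx]] := clA n I _ x_isolated.
  by exists x; split; [exists 0 | rewrite -[x]yx].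
have [m [m_cont m_base mK]] := rectifiable_translation G_rectifiable.
have /choice [U U_sep] n : exists U, nbhs (b n) U /\ nbhs x (~` U).
  exact: accessible_regular_separated (b_ne n).
(* The translates truncated to [U n]; membership in the [n]-th one is tested by
   translating back, so that a point of [A n] can be read off from it. *)
pose B := [set y | exists n, U n y /\ A n (m (x, b n, y))].
have /G_FU [y [/choice [i yB] y_cvg]] : closure B x.
  move=> N; rewrite nbhsE => -[O [O_open Ox] ON].
  have [n _ /(_ n (leqnn n)) /= On] := b_cvg O (open_nbhs_nbhs (conj O_open Ox)).
  have trans_cvg : m (b n, x, a) @[a --> x] --> b n.
    rewrite -[X in _ --> X](m_base (b n) x).
    apply: continuous_cvg; first exact: m_cont.
    exact: cvg_pair (cvg_cst (b n, x)) cvg_id.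
  have UOn : nbhs (b n) (U n `&` O).
    by apply: filterI; [exact: (U_sep n).1 | exact: open_nbhs_nbhs].
  have [a [Aa [Ua Oa]]] := clA n I _ (trans_cvg _ UOn).
  exists (m (b n, x, a)); split; last exact: ON.
  by exists n; rewrite mK.
(* A constant subsequence of indices [n] would keep [y] in [U n], away from
   its limit [x]. *)
have i_cvg : i @ \oo --> \oo.
  apply: cvg_indices => n.
  have : \forall k \near \oo, ~ U n (y k).
    by apply: (y_cvg (~` U n)); exact: (U_sep n).2.
  by apply: filterS => k nU ikn; apply: nU; rewrite -ikn; exact: (yB k).1.
exists (fun k => m (x, b (i k), y k)); split.
  rewrite -[X in _ --> X](m_base x x).
  apply: continuous_cvg; first exact: m_cont.
  exact: cvg_pair (cvg_pair (cvg_cst x) (cvg_comp _ _ i_cvg b_cvg)) y_cvg.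
(* [range i] is contained in the set of indices that are met, and is unbounded. *)
move=> /finite_seqP [s sE].
have [k _ /(_ k (leqnn k)) /= max_lt] : \forall k \near \oo, \max_(n <- s) n < i k.
  by apply: (i_cvg [set n | \max_(n <- s) n < n]); exact: nbhs_infty_gt.
have ik_s : i k \in s.
  suff : [set` s] (i k) by [].
  rewrite -sE /=; exists (m (x, b (i k), y k)).
  by split; [exists k | exact: (yB k).2].
by move: max_lt; rewrite ltnNge (@leq_bigmax_seq _ s xpredT id).
Qed.
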